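(* Let $G=K_{p_1,\dots,p_k}$ be the complete $k$-partite graph on the vertex set $[n]=[p_1]\sqcup\cdots\sqcup[p_k]$ with $p_1\ge\cdots\ge p_k$ (so $n=p_1+\cdots+p_k$). Let $S=K[x_v,y_v : v\in V(G)]$. Then $$\operatorname{Hilb}_{S/J_G}(t)=\sum_{i\in[k]}\frac{1}{(1-t)^{2p_i}}-\sum_{i\in[k]}\frac{(p_i-1)t+1}{(1-t)^{p_i+1}}+\frac{(n-1)t+1}{(1-t)^{n+1}}.$$ In particular, $\dim(S/J_G)=\max\{2p_1,n+1\}$ and $$e(S/J_G)=\begin{cases} n & \text{if } p_1=1 \text{ or } 2p_1<n+1,\\ 1 & \text{if } 2p_1>n+1,\\ n+1 & \text{if } 2p_1=n+1.\end{cases}$$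
   Context: $K$ is a field and $S$ is standard graded; $[m]=\{1,\dots,m\}$. The complete $k$-partite graph $K_{p_1,\dots,p_k}$ has vertex set partitioned into parts of sizes $p_1,\dots,p_k$, two vertices being adjacent exactly when they lie in different parts. The binomial edge ideal of a finite simple graph $G$ (with totally ordered vertex set) is $J_G=(x_iy_j-x_jy_i : \{i,j\}\in E(G),\ i<j)$. $\operatorname{Hilb}_M(t)=\sum_{m\ge0}\dim_K(M_m)t^m$ is the Hilbert series, $\dim$ is Krull dimension, and $e(M)$ is the multiplicity: if $\operatorname{Hilb}_M(t)=Q(t)/(1-t)^d$ with $d=\dim M$ and $Q$ a polynomial, then $e(M)=Q(1)$. *)

(* Defs.v *)
From HB Require Import structures.
From mathcomp Require Import all_boot all_order all_algebra.
From mathcomp Require Import boolp.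
From mathcomp Require Import mpoly.

Set Implicit Arguments.
Unset Strict Implicit.
Unset Printing Implicit Defensive.

Import GRing.Theory.
Local Open Scope ring_scope.
Local Open Scope quotient_scope.

Record fps (R : Type) := Fps { fps_coef : nat -> R }.

Lemma fps_ext (R : Type) (f g : fps R) : fps_coef f =1 fps_coef g -> f = g.
Proof. by case: f g => [f] [g] /= /funext ->. Qed.

HB.instance Definition _ (R : Type) := gen_eqMixin (fps R).
HB.instance Definition _ (R : Type) := gen_choiceMixin (fps R).

Section FpsZmodule.
Variable R : nzRingType.
Implicit Types f g h : fps R.

Definition fps_zero : fps R := Fps (fun _ => 0).
Definition fps_opp f : fps R := Fps (fun m => - fps_coef f m).
Definition fps_add f g : fps R := Fps (fun m => fps_coef f m + fps_coef g m).

Fact fps_addA : associative fps_add.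
Proof. by move=> f g h; apply: fps_ext => m /=; rewrite addrA. Qed.
Fact fps_addC : commutative fps_add.
Proof. by move=> f g; apply: fps_ext => m /=; rewrite addrC. Qed.
Fact fps_add0 : left_id fps_zero fps_add.
Proof. by move=> f; apply: fps_ext => m /=; rewrite add0r. Qed.
Fact fps_addN : left_inverse fps_zero fps_opp fps_add.
Proof. by move=> f; apply: fps_ext => m /=; rewrite addNr. Qed.

HB.instance Definition _ :=
  GRing.isZmodule.Build (fps R) fps_addA fps_addC fps_add0 fps_addN.

End FpsZmodule.

Section FpsRing.
Variable R : comNzRingType.
Implicit Types f g h : fps R.

Definition fps_of_poly (p : {poly R}) : fps R := Fps (fun m => p`_m).

Definition fps_one : fps R := fps_of_poly 1.
Definition fps_mul f g : fps R :=
  Fps (fun m => \sum_(i < m.+1) fps_coef f i * fps_coef g (m - i)%N).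

Definition fps_trunc (n : nat) f : {poly R} := \poly_(i < n) fps_coef f i.

Lemma coef_fps_trunc n f m : (m < n)%N -> (fps_trunc n f)`_m = fps_coef f m.
Proof. by move=> lt_mn; rewrite coef_poly lt_mn. Qed.

Lemma coef_fps_truncM n f g m : (m < n)%N ->
  (fps_trunc n f * fps_trunc n g)`_m = fps_coef (fps_mul f g) m.
Proof.
move=> lt_mn; rewrite coefM /=; apply: eq_bigr => i _.
rewrite !coef_fps_trunc //; first exact: leq_ltn_trans (leq_subr _ _) lt_mn.
by apply: leq_ltn_trans lt_mn; rewrite -ltnS.
Qed.

Fact fps_mulA : associative fps_mul.
Proof.
move=> f g h; apply: fps_ext => m.
transitivity ((fps_trunc m.+1 f * (fps_trunc m.+1 g * fps_trunc m.+1 h))`_m).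
  rewrite coefM /=; apply: eq_bigr => i _.
  by rewrite coef_fps_truncM ?ltnS ?leq_subr // coef_fps_trunc.
rewrite mulrA coefM /=; apply: eq_bigr => i _.
by rewrite coef_fps_truncM // coef_fps_trunc // ltnS leq_subr.
Qed.

Fact fps_mulC : commutative fps_mul.
Proof.
move=> f g; apply: fps_ext => m.
by rewrite -!(@coef_fps_truncM m.+1) // mulrC.
Qed.

Fact fps_mul1 : left_id fps_one fps_mul.
Proof.
move=> f; apply: fps_ext => m /=.
rewrite big_ord_recl /= coef1 mul1r subn0 big1 ?addr0 // => i _.
by rewrite coef1 mul0r.
Qed.

Fact fps_mulDl : left_distributive fps_mul +%R.
Proof.
move=> f g h; apply: fps_ext => m /=; rewrite -big_split /=.
by apply: eq_bigr => i _; rewrite mulrDl.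
Qed.

Fact fps_one_neq0 : fps_one != 0.
Proof.
apply/eqP => /(congr1 (fun f => fps_coef f 0)) /=; rewrite coef1.
exact/eqP/oner_neq0.
Qed.

HB.instance Definition _ := GRing.Zmodule_isComNzRing.Build (fps R)
  fps_mulA fps_mulC fps_mul1 fps_mulDl fps_one_neq0.

Definition fpsX : fps R := fps_of_poly 'X.

Lemma fps_coefD f g m : fps_coef (f + g) m = fps_coef f m + fps_coef g m.
Proof. by []. Qed.

Lemma fps_coefM f g m :
  fps_coef (f * g) m = \sum_(i < m.+1) fps_coef f i * fps_coef g (m - i)%N.
Proof. by []. Qed.

Fact fps_of_poly_is_zmod_morphism : zmod_morphism fps_of_poly.
Proof. by move=> p q; apply: fps_ext => m /=; rewrite coefB. Qed.

Fact fps_of_poly_is_monoid_morphism : monoid_morphism fps_of_poly.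
Proof. by split=> // p q; apply: fps_ext => m; rewrite fps_coefM /= coefM. Qed.

HB.instance Definition _ :=
  GRing.isZmodMorphism.Build {poly R} (fps R) fps_of_poly
    fps_of_poly_is_zmod_morphism.
HB.instance Definition _ :=
  GRing.isMonoidMorphism.Build {poly R} (fps R) fps_of_poly
    fps_of_poly_is_monoid_morphism.

End FpsRing.

Notation "'T" := (fpsX _) (at level 0) : ring_scope.

Section FpsUnitRing.
Variable R : comUnitRingType.
Implicit Types f g h : fps R.

Definition fps_unit : {pred fps R} :=
  fun f => fps_coef f 0 \is a GRing.unit.

(* The first n coefficients of the inverse of f, solved recursively from
   the equations [coef_m (f * f^-1) = (m == 0)]. *)
Fixpoint fps_inv_seq f (n : nat) : seq R :=
  if n is m.+1 then
    let s := fps_inv_seq f m in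
    rcons s ((fps_coef f 0)^-1 *
      ((m == 0%N)%:R - \sum_(i < m) fps_coef f (m - i)%N * s`_i))
  else [::].

Definition fps_inv f : fps R :=
  if f \in fps_unit then Fps (fun m => (fps_inv_seq f m.+1)`_m) else f.

Lemma size_fps_inv_seq f n : size (fps_inv_seq f n) = n.
Proof. by elim: n => //= n IHn; rewrite size_rcons IHn. Qed.

Lemma nth_fps_inv_seq f n m : (m < n)%N ->
  (fps_inv_seq f n)`_m = (fps_inv_seq f m.+1)`_m.
Proof.
elim: n => // n IHn; rewrite ltnS leq_eqVlt => /orP[/eqP-> //|lt_mn].
by rewrite -IHn // [fps_inv_seq f n.+1]/= nth_rcons size_fps_inv_seq lt_mn.
Qed.

Fact fps_mulVx : {in fps_unit, left_inverse 1 fps_inv *%R}.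
Proof.
move=> f f_unit; rewrite mulrC; apply: fps_ext => m.
rewrite fps_coefM /fps_inv f_unit big_ord_recl subn0 /=.
rewrite nth_rcons size_fps_inv_seq ltnn eqxx mulVKr //.
rewrite [RHS]coef1 -[RHS](subrK (\sum_(i < m) fps_coef f (m - i)%N *
  (fps_inv_seq f m)`_i)); congr (_ + _).
rewrite (reindex_inj rev_ord_inj) /=; apply: eq_bigr => i _.
rewrite /bump /= add1n subnSK // subKn ?(ltnW (ltn_ord i)) //; congr (_ * _).
by rewrite (@nth_fps_inv_seq f m) //= -[LHS]/((fps_inv_seq f i.+1)`_i).
Qed.

Fact fps_unitPl f g : g * f = 1 -> fps_unit f.
Proof.
move=> /(congr1 (fun h => fps_coef h 0)).
rewrite fps_coefM big_ord_recl big_ord0 addr0 /= coef1 mulrC => fg1.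
by apply/unitrPr; exists (fps_coef g 0).
Qed.

Fact fps_inv_out : {in [predC fps_unit], fps_inv =1 id}.
Proof. by move=> f; rewrite inE /= /fps_inv => /negbTE ->. Qed.

HB.instance Definition _ := GRing.ComNzRing_hasMulInverse.Build (fps R)
  fps_mulVx fps_unitPl fps_inv_out.

Lemma fps_unitE f : (f \is a GRing.unit) = (fps_coef f 0 \is a GRing.unit).
Proof. by []. Qed.

Lemma fps_subX_unit : (1 - 'T : fps R) \is a GRing.unit.
Proof. by rewrite fps_unitE /= coef1 coefX subr0 unitr1. Qed.

End FpsUnitRing.

Section KrullDimension.
Variable A : comNzRingType.

(* [idealr_closed] contains the properness condition [1 \notin P]. *)
Definition prime_ideal (P : {pred A}) : Prop :=
  idealr_closed P /\ prime_idealr_closed P.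

Definition prime_chain (d : nat) (P : nat -> {pred A}) : Prop :=
  (forall i, (i <= d)%N -> prime_ideal (P i)) /\
  (forall i, (i < d)%N ->
     {subset P i <= P i.+1} /\ ~ {subset P i.+1 <= P i}).

Definition krull_dim (d : nat) : Prop :=
  (exists P, prime_chain d P) /\
  (forall e P, prime_chain e P -> (e <= d)%N).

End KrullDimension.

Section HilbertSeries.
Variables (K : fieldType) (V : lmodType K).

(* The second clause says that W is the span of b, so W is in particular a
   subspace. *)
Definition has_dim (W : V -> Prop) (d : nat) : Prop :=
  exists b : 'I_d -> V,
    (forall c : 'I_d -> K,
       \sum_(i < d) c i *: b i = 0 -> forall i, c i = 0) /\
    (forall v, W v <-> exists c : 'I_d -> K, v = \sum_(i < d) c i *: b i).

(* Relational, so that finite-dimensionality of every piece V_ m is part of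
   the assertion. *)
Definition hilbert_series (V_ : nat -> V -> Prop) (H : fps int) : Prop :=
  forall m, exists2 d, has_dim (V_ m) d & fps_coef H m = d%:Z.

End HilbertSeries.

Definition multiplicity (K : fieldType) (A : comAlgType K)
    (A_ : nat -> A -> Prop) (e : int) : Prop :=
  exists d (Q : {poly int}),
    [/\ krull_dim A d,
        hilbert_series A_ (fps_of_poly Q / (1 - 'T) ^+ d) & e = Q.[1]].

Section MpolyQuotient.
Variables (K : fieldType) (N : nat) (I : idealr {mpoly K[N]}).

Local Notation S := {mpoly K[N]}.
Local Notation A := {ideal_quot I}.

Definition mquot_scale (a : K) (q : A) : A := \pi_A (a%:MP) * q.

Fact mquot_scaleA a b q :
  mquot_scale a (mquot_scale b q) = mquot_scale (a * b) q.
Proof. by rewrite /mquot_scale mulrA -rmorphM /= -mpolyCM. Qed.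
Fact mquot_scale1 : left_id 1 mquot_scale.
Proof. by move=> q; rewrite /mquot_scale rmorph1 mul1r. Qed.
Fact mquot_scaleDr : right_distributive mquot_scale +%R.
Proof. by move=> a q r; rewrite /mquot_scale mulrDr. Qed.
Fact mquot_scaleDl q : {morph mquot_scale^~ q : a b / a + b}.
Proof. by move=> a b; rewrite /mquot_scale !rmorphD /= mulrDl. Qed.

HB.instance Definition _ := GRing.Zmodule_isLmodule.Build K {ideal_quot I}
  mquot_scaleA mquot_scale1 mquot_scaleDr mquot_scaleDl.

Fact mquot_scaleAl (a : K) (q r : A) : a *: (q * r) = (a *: q) * r.
Proof. exact: mulrA. Qed.

HB.instance Definition _ := GRing.Lmodule_isLalgebra.Build K {ideal_quot I}
  mquot_scaleAl.
HB.instance Definition _ := GRing.Lalgebra_isComAlgebra.Build K {ideal_quot I}.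

Definition quot_piece (m : nat) (q : A) : Prop :=
  exists2 f : S, f \is m.-homog & q = \pi_A f.

End MpolyQuotient.

Definition ideal_span (R : nzRingType) (J : finType) (P : pred J) (g : J -> R) :
  {pred R} :=
  fun f => `[< exists c : J -> R, f = \sum_(j | P j) c j * g j >].

Record sgraph (n : nat) := SGraph {
  adj : rel 'I_n;
  adj_sym : ssrbool.symmetric adj;
  adj_irr : irreflexive adj }.

Section BinomialEdgeIdeal.
Variables (K : fieldType) (n : nat) (G : sgraph n).

Local Notation S := {mpoly K[n + n]}.

Definition xvar (v : 'I_n) : S := 'X_(lshift n v).
Definition yvar (v : 'I_n) : S := 'X_(rshift n v).

Definition edge_binomial (e : 'I_n * 'I_n) : S :=
  xvar e.1 * yvar e.2 - xvar e.2 * yvar e.1.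

Definition bei : {pred S} :=
  ideal_span [pred e : 'I_n * 'I_n | adj G e.1 e.2 & (e.1 < e.2)%N]
    edge_binomial.

Fact bei_idealr : idealr_closed bei.
Proof.
split.
- by apply/asboolP; exists (fun=> 0); rewrite big1 // => e _; rewrite mul0r.
- apply/asboolP => -[c] /(congr1 (meval (fun=> 0))) /eqP.
  rewrite rmorph1 rmorph_sum /= big1 ?oner_eq0 // => e _.
  by rewrite rmorphM rmorphB !rmorphM /= !mevalXU !mul0r subrr mulr0.
- move=> a f g /asboolP[c ->] /asboolP[d ->]; apply/asboolP.
  exists (fun e => a * c e + d e); rewrite mulr_sumr -big_split /=.
  by apply: eq_bigr => e _; rewrite mulrDl mulrA.
Qed.

HB.instance Definition _ := isIdealr.Build S bei bei_idealr.

Definition bei_quot : comAlgType K := {ideal_quot bei}.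

Definition bei_quot_piece : nat -> bei_quot -> Prop := @quot_piece K _ bei.

End BinomialEdgeIdeal.

Section CompleteMultipartite.
Variables (k : nat) (p : 'I_k -> nat).

(* [tagnat.sig1 v] is the index of the block of v in the decomposition of
   {0, ..., p_0 + ... + p_(k-1) - 1} into consecutive blocks of sizes p_i. *)
Definition multipartite_adj : rel 'I_(\sum_(i < k) p i) :=
  fun u v => tagnat.sig1 u != tagnat.sig1 v.

Fact multipartite_sym : ssrbool.symmetric multipartite_adj.
Proof. by move=> u v; rewrite /multipartite_adj eq_sym. Qed.
Fact multipartite_irr : irreflexive multipartite_adj.
Proof. by move=> u; rewrite /multipartite_adj eqxx. Qed.

Definition complete_multipartite : sgraph (\sum_(i < k) p i) :=
  SGraph multipartite_sym multipartite_irr.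

End CompleteMultipartite.

(* Main.v *)
(* Two monomials are congruent modulo J_G as soon as their supports meet two
   or more parts and they have the same degree at every vertex and the same total
   degree in the x's; a monomial supported on one part is congruent to no other
   monomial.  Since J_G is spanned by differences of congruent monomials, the
   Hilbert function counts congruence classes:
     sum_i C(2p_i+m-1, m) + (m+1) (C(n+m-1, m) - sum_i C(p_i+m-1, m)).
   For a strict chain of primes P_0 < ... < P_e, elements a_i of P_(i+1) \ P_i
   have monomials linearly independent modulo P_0, so the growth of the Hilbert
   function bounds e.  The bound is attained by a chain of primes through the
   coordinate ring of the largest part, or through the quotient by the 2-minors,
   embedded in a polynomial ring by x_v |-> s z_v, y_v |-> z_v. *)
From HB Require Import structures.
Require Import Defs.
From mathcomp Require Import all_boot all_order all_algebra.
From mathcomp Require Import boolp zify.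
From mathcomp Require Import mpoly.

Set Implicit Arguments.
Unset Strict Implicit.
Unset Printing Implicit Defensive.

Import GRing.Theory.
Local Open Scope ring_scope.
Local Open Scope quotient_scope.

(** * Krull dimension and growth *)

(** If [U] were smaller than [T], the coordinate matrix of [b] over [w] would have a nonzero left
    kernel vector, which is a dependency among the [b t]. *)
Lemma leq_card_independent (K : fieldType) (V : lmodType K) (T U : finType)
    (b : T -> V) (w : U -> V) :
  (forall c : T -> K, \sum_t c t *: b t = 0 -> forall t, c t = 0) ->
  (forall t, exists c : U -> K, b t = \sum_u c u *: w u) ->
  (#|T| <= #|U|)%N.
Proof.
move=> b_free /choice[C bE]; rewrite leqNgt; apply/negP => lt_UT.
pose M := \matrix_(i < #|T|, j < #|U|) C (enum_val i) (enum_val j).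
have : kermx M != 0.
  rewrite -mxrank_eq0 mxrank_ker subn_eq0 -ltnNge.
  exact: leq_ltn_trans (rank_leq_col M) lt_UT.
case/rowV0Pn => v /sub_kermxP vM0 /eqP; apply; apply/rowP => i.
rewrite mxE -[i]enum_valK.
apply: (b_free (fun t => v 0 (enum_rank t))).
under eq_bigr do rewrite bE scaler_sumr.
rewrite exchange_big big1 //= => u _.
under eq_bigr do rewrite scalerA.
rewrite -scaler_suml (reindex (@enum_val T T)) /=;
  last exact/onW_bij/enum_val_bij.
have /rowP/(_ (enum_rank u)) := vM0; rewrite !mxE => vM0u.
rewrite (eq_bigr (fun j => v 0 j * M j (enum_rank u))) ?vM0u ?scale0r // => j _.
by rewrite mxE enum_valK enum_rankK.
Qed.

Lemma leq_exp_of_poly_growth (C c d e : nat) :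
  (forall m, m ^ e <= C * (c * m).+1 ^ d)%N -> (e <= d)%N.
Proof.
move=> growth; rewrite leqNgt; apply/negP => lt_de.
(* This [m] exceeds [C * c.+1 ^ d], and [(c * m).+1 <= c.+1 * m], so the growth bound falls below
   [m ^ d.+1 <= m ^ e]. *)
pose m := (C * c.+1 ^ d).+1.
have := growth m; apply/negP; rewrite -ltnNge.
have le1 : (C * (c * m).+1 ^ d <= C * c.+1 ^ d * m ^ d)%N.
  rewrite -mulnA -expnMn leq_mul2l; apply/orP; right.
  case: (d) => // d'; rewrite leq_exp2r // mulSn.
  by rewrite /m addSn ltnS leq_addl.
apply: leq_ltn_trans le1 _; apply: (@leq_trans (m ^ d.+1)%N).
  by rewrite expnS ltn_mul2r expn_gt0 /= ltnS.
by rewrite leq_pexp2l.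
Qed.

Section KrullUpperBound.
Variables (K : fieldType) (A : comAlgType K) (F : nat -> A -> Prop).
Hypothesis F1 : F 0 1.
Hypothesis FM : forall i j a b, F i a -> F j b -> F (i + j) (a * b).
Hypothesis Fle : forall i j a, (i <= j)%N -> F i a -> F j a.
Hypothesis Ffull : forall a, exists i, F i a.

Lemma idealr_closedMl (P : {pred A}) a u :
  idealr_closed P -> u \in P -> a * u \in P.
Proof. by case=> P0 _ PD Pu; rewrite -[_ * _]addr0 PD. Qed.

Lemma filtrationX i a m : F i a -> F (i * m) (a ^+ m).
Proof.
move=> Fa; elim: m => [|m IHm]; first by rewrite muln0 expr0.
by rewrite mulnS exprS; apply: FM.
Qed.

(* Reduce modulo [Q] to kill the constant term in [a], then cancel [a] modulo
   [P]. *)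
Lemma independent_powers (P Q : {pred A}) (T : finType) (b : T -> A) a m
    (lam : nat -> T -> K) :
  prime_ideal P -> prime_ideal Q -> {subset P <= Q} -> a \in Q -> a \notin P ->
  (forall c : T -> K, \sum_t c t *: b t \in Q -> forall t, c t = 0) ->
  \sum_(q < m) \sum_t lam q t *: (a ^+ q * b t) \in P ->
  forall q t, (q < m)%N -> lam q t = 0.
Proof.
move=> [idP prP] [idQ prQ] sPQ Qa Pa b_free.
elim: m lam => // m IHm lam; rewrite big_ord_recl /=.
set s0 := \sum_t _; set s := \sum_(q < m) _.
pose s' := \sum_(q < m) \sum_t lam q.+1 t *: (a ^+ q * b t).
have -> : s = a * s'.
  rewrite mulr_sumr; apply: eq_bigr => q _; rewrite mulr_sumr.
  by apply: eq_bigr => t _; rewrite exprS -scalerAr mulrA.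
have s0E : s0 = \sum_t lam 0 t *: b t by apply: eq_bigr => t _; rewrite mul1r.
move=> Ps; have lam0 : forall t, lam 0 t = 0.
  apply: b_free; rewrite -s0E.
  have Qas : a * s' \in Q by rewrite mulrC; apply: idealr_closedMl.
  have [_ _ QD] := idQ.
  rewrite -[s0](addrK (a * s')) addrC -mulN1r.
  by apply: QD => //; apply: sPQ.
case=> [|q] t; rewrite ?lam0 // ltnS; apply: (IHm (fun q => lam q.+1)).
have s00 : s0 = 0 by rewrite s0E big1 // => t' _; rewrite lam0 scale0r.
by move: Ps; rewrite s00 add0r => /prP; rewrite (negPf Pa).
Qed.

(** Induction along the chain: for [a] in [P 1] outside [P 0] and [b] independent modulo [P 1], the
    products [a ^+ q * b t] with [q < m] are independent modulo [P 0]. Each further prime multiplies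
    their number by [m], while the filtration degree stays linear in [m], with [C] independent of
    [m]. *)
Lemma prime_chain_independent e (P : nat -> {pred A}) : prime_chain e P ->
  exists C, forall m, exists (T : finType) (b : T -> A),
    [/\ #|T| = (m ^ e)%N, forall t, F (C * m) (b t) &
        forall c : T -> K, \sum_t c t *: b t \in P 0 -> forall t, c t = 0].
Proof.
elim: e P => [|e IHe] P [Ppr Pchain].
  exists 0%N => m; exists unit, (fun=> 1); split=> [||c Pc []].
  - by rewrite card_unit.
  - by rewrite mul0n.
  have [idP _] := Ppr 0 isT; have [_ P1 _] := idP.
  apply/eqP/negPn/negP => c0.
  move: Pc; rewrite (big_pred1 tt) => [Pc|[] //].
  case/negP: P1; rewrite -(scale1r 1) -(mulVf c0) -scalerA -mulr_algl.
  exact: idealr_closedMl.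
have [|C HC] := IHe (fun i => P i.+1).
  by split=> i lt_ie; [apply: Ppr | apply: Pchain].
have [sP /existsNP[a /not_implyP[P1a /negP P0a]]] := Pchain 0 isT.
have [i Fa] := Ffull a.
exists (i + C)%N => m; have [T [b [cardT Fb b_free]]] := HC m.
exists ('I_m * T)%type, (fun qt : 'I_m * T => a ^+ qt.1 * b qt.2); split.
- by rewrite card_prod card_ord cardT expnS.
- case=> q t /=; rewrite mulnDl; apply: FM => //.
  by apply: Fle (filtrationX q Fa); rewrite leq_mul2l ltnW ?orbT.
move=> c Pc [q t].
(* [c] is extended by 0 to all natural exponents, the form required by [independent_powers]. *)
pose lam q t := if insub q is Some q' then c (q', t) else 0.
have lamE (q' : 'I_m) t' : lam q' t' = c (q', t') by rewrite /lam valK.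
rewrite -lamE; apply: (@independent_powers (P 0) (P 1) T b a m) => //.
- exact: Ppr.
- exact: Ppr.
rewrite pair_bigA /=.
rewrite (eq_bigr (fun r : 'I_m * T => c r *: (a ^+ r.1 * b r.2))) //.
by move=> [q' t'] _ /=; rewrite lamE.
Qed.

(** The [m ^ e] independent elements lie in a level spanned by at most [C * (c * m).+1 ^ d]
    elements, for every [m]. *)
Lemma prime_chain_leq C d :
  (forall D, exists (U : finType) (w : U -> A),
     (#|U| <= C * D.+1 ^ d)%N /\
     (forall a, F D a -> exists c : U -> K, a = \sum_u c u *: w u)) ->
  forall e (P : nat -> {pred A}), prime_chain e P -> (e <= d)%N.
Proof.
move=> dimF e P chP; have [c Hc] := prime_chain_independent chP.
apply: (@leq_exp_of_poly_growth C c) => m.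
have [T [b [<- Fb b_free]]] := Hc m; have [U [w [leU wP]]] := dimF (c * m)%N.
apply: leq_trans leU.
apply: (leq_card_independent (b := b) (w := w)) => [l l0|t]; last exact: wP.
(* Independence modulo [P 0] gives independence in [A], since [P 0] contains 0. *)
by apply: b_free; rewrite l0; have [[] []] := chP.1 0 isT.
Qed.

End KrullUpperBound.

(** * The degree filtration on a quotient of a polynomial ring *)

Section QuotientFiltration.
Variables (K : fieldType) (N : nat) (I : idealr {mpoly K[N]}).
Local Notation S := {mpoly K[N]}.
Local Notation A := {ideal_quot I}.

Lemma pi_eq0 (f : S) : (\pi_A f == 0) = (f \in I).
Proof. by rewrite -[0](rmorph0 \pi_A) -Quotient.idealrBE subr0. Qed.

Lemma pi_scale a (f : S) : \pi_A (a *: f) = a *: \pi_A f.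
Proof. by rewrite -mul_mpolyC rmorphM. Qed.

(** [msize] is the total degree plus one, so level [D] is the image of the polynomials of degree at
    most [D]. *)
Definition quot_filtration (D : nat) (q : A) : Prop :=
  exists2 f : S, (msize f <= D.+1)%N & q = \pi_A f.

Lemma quot_filtration_dim (h : nat -> nat) (D : nat) :
  (forall m, has_dim (@quot_piece K N I m) (h m)) ->
  exists (U : finType) (w : U -> A), #|U| = (\sum_(m < D.+1) h m)%N /\
    (forall a, quot_filtration D a -> exists c : U -> K, a = \sum_u c u *: w u).
Proof.
move=> h_dim; pose b m := sval (cid (h_dim m)).
have hb m := svalP (cid (h_dim m)); rewrite -/(b _) in hb.
exists {m : 'I_D.+1 & 'I_(h m)}, (fun u => b _ (tagged u)); split.
  by rewrite card_tagged sumnE big_map big_enum; apply: eq_bigr => i _;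
    rewrite card_ord.
move=> _ [f le_fD ->].
have c_ex (m : 'I_D.+1) : exists c : 'I_(h m) -> K,
    \pi_A (pihomog mdeg m f) = \sum_i c i *: b m i.
  have [_ /(_ (\pi_A (pihomog mdeg m f)))[+ _]] := hb m.
  by apply; exists (pihomog mdeg m f); rewrite ?pihomogP.
pose c m := sval (cid (c_ex m)).
have cE (m : 'I_D.+1) : \pi_A (pihomog mdeg m f) = \sum_i c m i *: b m i.
  exact: svalP (cid (c_ex m)).
exists (fun u => c _ (tagged u)).
rewrite {1}(pihomog_partitionE le_fD) rmorph_sum /=.
under eq_bigr do rewrite cE.
by rewrite sig_big_dep.
Qed.

(** Summing the bound on [h] over the degrees up to [D] bounds level [D] by [C * D.+1 ^ d.+1],
    whence the shift from [d] to [d.+1]. *)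
Lemma quot_prime_chain_leq (h : nat -> nat) (C d : nat) :
  (forall m, has_dim (@quot_piece K N I m) (h m)) ->
  (forall m, h m <= C * m.+1 ^ d)%N ->
  forall e (P : nat -> {pred A}), prime_chain e P -> (e <= d.+1)%N.
Proof.
move=> h_dim h_le; apply: (@prime_chain_leq K A quot_filtration _ _ _ _ C d.+1).
- by exists 1; rewrite ?msize1 ?rmorph1.
- move=> i j _ _ [f lef ->] [g leg ->]; exists (f * g); last by rewrite rmorphM.
  have [->|f0] := eqVneq f 0; first by rewrite mul0r msize0.
  have [->|g0] := eqVneq g 0; first by rewrite mulr0 msize0.
  rewrite msizeM //; apply: (@leq_trans (i.+1 + j.+1).-1); last by rewrite addnS.
  by rewrite -!subn1 leq_sub2r // leq_add.
- by move=> i j _ le_ij [f lef ->]; exists f => //; apply: leq_trans lef _.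
- by move=> a; exists (msize (repr a)); exists (repr a); rewrite ?leqnSn ?reprK.
move=> D; have [U [w [cardU wP]]] := quot_filtration_dim D h_dim.
exists U, w; split=> //; rewrite cardU expnS mulnCA.
rewrite -[X in (_ <= X * _)%N](card_ord D.+1) -sum_nat_const.
apply: leq_sum => m _; apply: leq_trans (h_le m) _.
rewrite leq_mul2l; apply/orP; right.
by case: (d) => // d'; rewrite leq_exp2r // ltnS -ltnS.
Qed.

End QuotientFiltration.

(** * Classes of monomials *)

Section MonomialClasses.
Variables (K : fieldType) (N : nat) (C : eqType) (cl : 'X_{1..N} -> C).
Local Notation S := {mpoly K[N]}.

(** The bound [b] makes the sum finite. On an ideal where these functionals vanish, they descend to
    the quotient and separate the classes. *)
Definition class_sum (b : nat) (c : C) (f : S) : K :=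
  \sum_(m : 'X_{1..N < b} | cl m == c) f@_m.

Lemma class_sum_linear b c (J : Type) (r : seq J) (P : pred J) (a : J -> K)
    (g : J -> S) :
  class_sum b c (\sum_(j <- r | P j) a j *: g j) =
  \sum_(j <- r | P j) a j * class_sum b c (g j).
Proof.
rewrite /class_sum; under [RHS]eq_bigr do rewrite mulr_sumr.
rewrite [RHS]exchange_big; apply: eq_bigr => m _ /=.
by rewrite raddf_sum; apply: eq_bigr => j _ /=; rewrite mcoeffZ.
Qed.

Lemma class_sumX b c (m : 'X_{1..N}) :
  class_sum b c 'X_[m] = ((mdeg m < b)%N && (cl m == c))%:R.
Proof.
rewrite /class_sum; under eq_bigr do rewrite mcoeffX.
have [lt_mb|le_bm] /= := ltnP; last first.
  rewrite big1 // => m' _; case: eqP => // def_m; move: le_bm.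
  by rewrite def_m leqNgt bmdeg.
pose m0 : 'X_{1..N < b} := BMultinom lt_mb.
have [cm|ncm] := boolP (cl m == c).
  rewrite (bigD1 m0) //= eqxx big1 ?addr0 // => m' /andP[_ m'N].
  by rewrite -[m]/(val m0) (inj_eq val_inj) eq_sym (negPf m'N).
rewrite big1 // => m' cm'; case: eqP => // def_m.
by move: ncm; rewrite def_m cm'.
Qed.

Variable I : idealr S.
Hypothesis cl_congr : forall m m', cl m = cl m' -> 'X_[m] - 'X_[m'] \in I.
Hypothesis class_sum0 : forall b c f, f \in I -> class_sum b c f = 0.

(** One representative per class spans, because congruent monomials agree in the quotient; the class
    sums form a dual family, which gives independence. *)
Lemma has_dim_classes (d : nat) (cs : seq C) :
  uniq cs ->
  (forall c, c \in cs -> exists2 m, mdeg m = d & cl m = c) ->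
  (forall m, mdeg m = d -> cl m \in cs) ->
  has_dim (@quot_piece K N I d) (size cs).
Proof.
move=> cs_uniq cs_ex cs_all.
have /choice[s sP] (i : 'I_(size cs)) :
    exists m, mdeg m = d /\ cl m = tnth (in_tuple cs) i.
  have [m] := cs_ex _ (mem_tnth i (in_tuple cs)).
  by exists m.
have pi_sum c : \sum_i c i *: \pi_{ideal_quot I} 'X_[s i] =
    \pi_{ideal_quot I} (\sum_i c i *: 'X_[s i]).
  by rewrite rmorph_sum /=; apply: eq_bigr => i _; rewrite pi_scale.
exists (fun i => \pi 'X_[s i]); split=> [c|v].
  rewrite pi_sum => /eqP; rewrite pi_eq0 => cI j.
  (* The bound [d.+1] keeps every monomial of degree [d], so this functional is 1 at [s j] and 0 at
     the other representatives. *)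
  have := class_sum0 d.+1 (tnth (in_tuple cs) j) cI.
  rewrite class_sum_linear (bigD1 j) //= class_sumX.
  have [-> ->] := sP j; rewrite ltnSn eqxx mulr1 big1 ?addr0 // => i iNj.
  rewrite class_sumX; have [-> ->] := sP i.
  by rewrite ltnSn /= (inj_eq (elimT (tuple_uniqP (in_tuple cs)) cs_uniq))
    (negPf iNj) mulr0.
split=> [[f f_hom ->]|[c ->]]; last first.
  rewrite pi_sum; eexists; last by [].
  by apply: rpred_sum => i _; apply: rpredZ; rewrite dhomogX;
    apply/eqP/(sP i).1.
rewrite [f]mpolyE rmorph_sum big_seq /=.
apply: (big_ind (fun v => exists c,
  v = \sum_i c i *: \pi_{ideal_quot I} 'X_[s i])).
- by exists (fun=> 0); rewrite big1 // => i _; rewrite scale0r.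
- move=> _ _ [c ->] [c' ->]; exists (fun i => c i + c' i); rewrite -big_split.
  by apply: eq_bigr => i _; rewrite scalerDl.
move=> m m_f; have cs_m := cs_all m (dhomog_mf f_hom m_f).
have /tnthP[i cl_m] : cl m \in in_tuple cs by [].
exists (fun j => f@_m *+ (j == i)); rewrite (bigD1 i) //= eqxx big1 ?addr0.
  rewrite pi_scale; congr (_ *: _); apply/eqP.
  by rewrite -Quotient.idealrBE cl_congr // cl_m (sP i).2.
by move=> j /negPf ->; rewrite scale0r.
Qed.

End MonomialClasses.

Section Spread.
Variables (N k : nat) (col : 'I_N -> 'I_k).

Definition spread (m : 'X_{1..N}) :=
  [exists u, exists v, [&& m u != 0, m v != 0 & col u != col v]]%N.

Lemma spreadP (m : 'X_{1..N}) :
  reflect (exists u v, [/\ m u != 0, m v != 0 & col u != col v])%N (spread m).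
Proof.
apply: (iffP existsP) => [[u /existsP[v /and3P[]]]|[u [v [mu mv cuv]]]].
  by exists u, v.
by exists u; apply/existsP; exists v; apply/and3P.
Qed.

Definition supported (A : pred 'I_N) (m : 'X_{1..N}) :=
  [forall u, (m u != 0%N) ==> A u].

Lemma supportedP (A : pred 'I_N) (m : 'X_{1..N}) :
  reflect (forall u, m u != 0%N -> A u) (supported A m).
Proof. exact: (iffP 'forall_implyP). Qed.

(** The only colour that can contain the support is that of any [u] in it, and it does so exactly
    when [m] is not spread. The constant monomial is excluded because it is supported on every
    colour. *)
Lemma sum_supported_col (m : 'X_{1..N}) : m != 0%MM ->
  (\sum_(i < k) supported (fun u => col u == i) m)%N = ~~ spread m.
Proof.
move=> m0; have [u mu] : exists u, m u != 0%N.
  apply/existsP; rewrite -negb_forall; apply: contra m0 => /forallP m0.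
  by apply/eqP/mnmP => u; rewrite mnm0E; apply/eqP/m0.
have supp_u i : supported (fun v => col v == i) m -> i = col u.
  by move/supportedP/(_ u mu)/eqP.
rewrite (bigD1 (col u)) //= big1 ?addn0 => [|i iN]; last first.
  by case: (boolP (supported _ _)) => // /supp_u i_u; rewrite i_u eqxx in iN.
congr nat_of_bool; apply/supportedP/negP.
  move=> sup /spreadP[v [w [mv mw]]].
  by rewrite (eqP (sup v mv)) (eqP (sup w mw)) eqxx.
move=> nspr v mv; apply/negPn/negP => cvu.
by apply: nspr; apply/spreadP; exists v, u.
Qed.

End Spread.

Lemma addmCA N : left_commutative (@mnm_add N).
Proof. by move=> m1 m2 m3; rewrite !addmA [(m1 + m2)%MM]addmC. Qed.

Lemma addmCAC N (m1 m2 m3 : 'X_{1..N}) :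
  (m1 + (m2 + m3) = m3 + (m2 + m1))%MM.
Proof. by rewrite addmC -addmA addmCA. Qed.

Section VertexDegrees.
Variables (n k : nat) (part : 'I_n -> 'I_k).

Definition vertex (j : 'I_(n + n)) : 'I_n :=
  match split j with inl v => v | inr v => v end.

Lemma vertex_lshift v : vertex (lshift n v) = v.
Proof. by rewrite /vertex (unsplitK (inl v)). Qed.

Lemma vertex_rshift v : vertex (rshift n v) = v.
Proof. by rewrite /vertex (unsplitK (inr v)). Qed.

(** Every edge binomial is homogeneous both for this multigrading by vertices and for [xdeg]. *)
Definition vdeg (m : 'X_{1..n + n}) : 'X_{1..n} :=
  [multinom (m (lshift n v) + m (rshift n v))%N | v < n].

Definition xdeg (m : 'X_{1..n + n}) : nat := (\sum_v m (lshift n v))%N.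

Lemma vdegE m v : vdeg m v = (m (lshift n v) + m (rshift n v))%N.
Proof. exact: mnmE. Qed.

Lemma vdegD m1 m2 : vdeg (m1 + m2)%MM = (vdeg m1 + vdeg m2)%MM.
Proof. by apply/mnmP => v; rewrite !(vdegE, mnmDE) addnACA. Qed.

Lemma vdeg1 j : vdeg U_(j)%MM = U_(vertex j)%MM.
Proof.
apply/mnmP => v; rewrite vdegE !mnm1E -(splitK j); case: (split j) => u /=.
  by rewrite vertex_lshift eq_lshift eq_lrshift addn0.
by rewrite vertex_rshift eq_rshift eq_rlshift.
Qed.

Lemma xdegD m1 m2 : xdeg (m1 + m2)%MM = (xdeg m1 + xdeg m2)%N.
Proof. by rewrite /xdeg -big_split; apply: eq_bigr => v _; rewrite mnmDE. Qed.

Lemma xdeg_lshift v : xdeg U_(lshift n v)%MM = 1%N.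
Proof.
rewrite /xdeg (bigD1 v) //= mnm1E eqxx big1 // => w wNv.
by rewrite mnm1E eq_lshift eq_sym (negPf wNv).
Qed.

Lemma xdeg_rshift v : xdeg U_(rshift n v)%MM = 0%N.
Proof. by rewrite /xdeg big1 // => w _; rewrite mnm1E eq_rlshift. Qed.

Lemma mdeg_vdeg m : mdeg (vdeg m) = mdeg m.
Proof.
rewrite !mdegE big_split_ord /= -big_split; apply: eq_bigr => v _.
exact: vdegE.
Qed.

Lemma vdeg_neq0P (m : 'X_{1..n + n}) w :
  reflect (exists2 z, m z != 0%N & vertex z = w) (vdeg m w != 0%N).
Proof.
rewrite vdegE addn_eq0 negb_and; apply: (iffP orP) => [[] mw|[z]].
- by exists (lshift n w); rewrite ?vertex_lshift.
- by exists (rshift n w); rewrite ?vertex_rshift.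
rewrite -(splitK z); case: (split z) => w' /=.
  by rewrite vertex_lshift => mz <-; left.
by rewrite vertex_rshift => mz <-; right.
Qed.

Lemma spread_vdeg m : spread part (vdeg m) = spread (part \o vertex) m.
Proof.
apply/spreadP/spreadP => [[u [v [/vdeg_neq0P[u' mu <-]]]]|[u [v [mu mv uv]]]].
  by case/vdeg_neq0P=> v' mv <- uv; exists u', v'.
exists (vertex u), (vertex v).
by split=> //; apply/vdeg_neq0P; [exists u | exists v].
Qed.

(* Equality of classes is congruence of monomials modulo the binomial edge
   ideal. *)
Definition mclass (m : 'X_{1..n + n}) : 'X_{1..n + n} + 'X_{1..n} * nat :=
  if spread part (vdeg m) then inr (vdeg m, xdeg m) else inl m.

End VertexDegrees.

(** * Congruence of monomials modulo the edge ideal *)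

Section MultipartiteIdeal.
Variables (K : fieldType) (n k : nat) (part : 'I_n -> 'I_k) (G : sgraph n).
Hypothesis adjE : forall u v, adj G u v = (part u != part v).
Local Notation S := {mpoly K[n + n]}.
Local Notation xi v := U_(lshift n v)%MM.
Local Notation yi v := U_(rshift n v)%MM.
Local Notation J := (@bei K n G).

Lemma edge_binomialE (u v : 'I_n) :
  edge_binomial K (u, v) = 'X_[xi u + yi v] - 'X_[xi v + yi u].
Proof. by rewrite !mpolyXD. Qed.

Definition mcongr (m m' : 'X_{1..n + n}) : Prop := ('X_[m] : S) - 'X_[m'] \in J.

Lemma mcongr_refl m : mcongr m m.
Proof. by rewrite /mcongr subrr rpred0. Qed.

Lemma mcongr_sym m m' : mcongr m m' -> mcongr m' m.
Proof. by rewrite /mcongr -opprB rpredN. Qed.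

Lemma mcongr_trans m1 m2 m3 : mcongr m1 m2 -> mcongr m2 m3 -> mcongr m1 m3.
Proof. by move=> h12 h23; rewrite /mcongr -(subrKA 'X_[m2]) rpredD. Qed.

Lemma mcongr_add m m1 m2 : mcongr m1 m2 -> mcongr (m + m1)%MM (m + m2)%MM.
Proof. by rewrite /mcongr !mpolyXD -mulrBr; apply: idealMr. Qed.

Lemma mcongr_edge u v : part u != part v ->
  mcongr (xi u + yi v)%MM (xi v + yi u)%MM.
Proof.
wlog lt_uv : u v / (u < v)%N => [H uv|uv].
  have [|lt_vu|eq_uv] := ltngtP u v; first by move/H; apply.
    by apply/mcongr_sym/H => //; rewrite eq_sym.
  by rewrite (val_inj eq_uv) eqxx in uv.
rewrite /mcongr -edge_binomialE; apply/asboolP.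
exists (fun e => (e == (u, v))%:R); rewrite (bigD1 (u, v)) /=;
  last by rewrite adjE uv lt_uv.
rewrite eqxx mul1r big1 ?addr0 // => e /andP[_ /negPf ->].
by rewrite mul0r.
Qed.

(** If [u] and [v] lie in different parts, this is a multiple of a generator. Otherwise some [w]
    from another part occurs in [m], and the exchange is made in two steps through [w]. *)
Lemma mcongr_swap m u v : spread part (vdeg (m + (xi u + yi v))%MM) ->
  mcongr (m + (xi u + yi v))%MM (m + (xi v + yi u))%MM.
Proof.
have [uv|uv] := eqVneq (part u) (part v); last first.
  by move=> _; apply/mcongr_add/mcongr_edge.
case/spreadP => a [b [ma mb ab]].
have [w mw uw] :
    exists2 w, vdeg (m + (xi u + yi v))%MM w != 0%N & part u != part w.
  have [ua|] := eqVneq (part u) (part a); last by exists a.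
  by exists b; rewrite // ua.
have [z mz zw] : exists2 z, m z != 0%N & vertex z = w.
  apply/vdeg_neq0P; move: mw.
  rewrite !vdegD !vdeg1 vertex_lshift vertex_rshift !mnmDE !mnm1E.
  have /negPf -> : u != w by apply: contraNneq uw => ->.
  have /negPf -> : v != w by rewrite uv in uw; apply: contraNneq uw => ->.
  by rewrite !addn0.
have -> : m = (m - U_(z) + U_(z))%MM by rewrite submK // lep1mP.
rewrite -![(_ + U_(z) + _)%MM]addmA; apply: mcongr_add.
have vw : part v != part w by rewrite -uv.
move: zw; rewrite -(splitK z); case: (split z) => w' /=.
  rewrite vertex_lshift => ->.
  (* [x_w x_u y_v -> x_u x_v y_w -> x_w x_v y_u], along the edges [vw] and then [uw]. *)
  apply: (@mcongr_trans _ (xi u + (xi v + yi w))%MM).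
    rewrite addmCA; apply: mcongr_add; apply/mcongr_sym.
    exact: mcongr_edge.
  rewrite addmCA [X in mcongr _ X]addmCA; apply: mcongr_add.
  exact: mcongr_edge.
rewrite vertex_rshift => ->.
(* [y_w x_u y_v -> y_v x_w y_u -> y_w x_v y_u], along the edges [uw] and then [vw]. *)
apply: (@mcongr_trans _ (yi v + (xi w + yi u))%MM).
  by rewrite addmCAC; apply/mcongr_add/mcongr_edge.
rewrite addmCAC [X in mcongr _ X]addmCAC; apply/mcongr_add/mcongr_edge.
by rewrite eq_sym.
Qed.

(** Induction on the total excess of the x-exponents of [m] over those of [m'], with truncated
    differences. Equal [xdeg] turns a surplus at some [u] into a deficit at some [v], and replacing
    [x_u y_v] by [x_v y_u] lowers the excess. *)
Lemma mcongr_vdeg_xdeg m m' : spread part (vdeg m) ->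
  vdeg m = vdeg m' -> xdeg m = xdeg m' -> mcongr m m'.
Proof.
have [d] := ubnP (\sum_v (m (lshift n v) - m' (lshift n v)))%N.
elim: d m => // d IHd m; rewrite ltnS => le_d spr eq_v eq_x.
have [le_mm'|] := boolP [forall v, (m (lshift n v) <= m' (lshift n v))%N].
  have eq_xv v : m (lshift n v) = m' (lshift n v).
    have [_] := leqif_sum (fun v (_ : true) => leqif_eq (forallP le_mm' v)).
    rewrite -/(xdeg m) -/(xdeg m') eq_x eqxx => /esym/forallP/(_ v).
    by move/implyP/(_ isT)/eqP.
  suff -> : m = m' by exact: mcongr_refl.
  apply/mnmP => j; rewrite -(splitK j); case: (split j) => v //=.
  have /mnmP/(_ v) := eq_v; rewrite !vdegE eq_xv; exact: addnI.
rewrite negb_forall => /existsP[u]; rewrite -ltnNge => lt_u.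
have [v lt_v] : exists v, (m (lshift n v) < m' (lshift n v))%N.
  apply/existsP; apply: contraLR (lt_u); rewrite -leqNgt negb_exists => le_m'm.
  have {}le_m'm v : (m' (lshift n v) <= m (lshift n v))%N.
    by rewrite leqNgt; apply: (forallP le_m'm).
  have [_] := leqif_sum (fun v (_ : true) => leqif_eq (le_m'm v)).
  rewrite -/(xdeg m) -/(xdeg m') eq_x eqxx => /esym/forallP/(_ u).
  by move/implyP/(_ isT)/eqP => ->.
have uv : u != v by apply: contraTneq lt_u => ->; rewrite -leqNgt ltnW.
have mu : m (lshift n u) != 0%N by rewrite -lt0n; apply: leq_ltn_trans lt_u.
(* The vertex degrees at [v] agree, so a deficit in [x_v] is a surplus in [y_v]. *)
have mv : m (rshift n v) != 0%N.
  have /mnmP/(_ v) := eq_v; rewrite !vdegE => eq_v'.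
  by rewrite -lt0n -(ltn_add2l (m (lshift n v))) eq_v' addn0 ltn_addr.
pose m0 := (m - (xi u + yi v))%MM.
have mE : m = (m0 + (xi u + yi v))%MM.
  rewrite submK //; apply/mnm_lepP => j; rewrite mnmDE !mnm1E.
  case: eqP => [<-|_]; last by case: eqP => // <-; rewrite lt0n.
  by rewrite eq_rlshift addn0 lt0n.
have eq_v1 : vdeg (m0 + (xi v + yi u))%MM = vdeg m.
  rewrite mE !vdegD !vdeg1 !vertex_lshift !vertex_rshift; congr (_ + _)%MM.
  exact: addmC.
apply: (@mcongr_trans _ (m0 + (xi v + yi u))%MM).
  by rewrite [X in mcongr X _]mE; apply: mcongr_swap; rewrite -mE.
apply: IHd; rewrite ?eq_v1 //; last first.
  by rewrite -eq_x mE !xdegD !xdeg_lshift !xdeg_rshift.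
apply: leq_trans le_d.
(* The term of [u] drops by one; that of [v] stays 0, since [m] was strictly below [m'] there. *)
rewrite (bigD1 u) //= [X in (_ < X)%N](bigD1 u) //= -addSn.
have m1E w :
    (m0 + (xi v + yi u))%MM (lshift n w) = (m0 (lshift n w) + (v == w))%N.
  by rewrite !mnmDE !mnm1E eq_lshift eq_rlshift addn0.
have mE' w : m (lshift n w) = (m0 (lshift n w) + (u == w))%N.
  by rewrite {1}mE !mnmDE !mnm1E eq_lshift eq_rlshift addn0.
apply: leq_add => [|].
  move: lt_u; rewrite m1E mE' eqxx eq_sym (negPf uv) addn0 addn1 ltnS => le_u.
  by rewrite subSn.
apply: leq_sum => w wNu; rewrite m1E mE' [u == w]eq_sym (negPf wNu) addn0.
case: eqP => [<-|_]; last by rewrite addn0.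
by move: lt_v; rewrite mE' (negPf uv) addn0 addn1 -subn_eq0 => /eqP ->.
Qed.

Lemma mclass_congr m m' : mclass part m = mclass part m' -> mcongr m m'.
Proof.
rewrite /mclass; case: ifP => [spr|_]; case: ifP => // _.
  move/eqP; rewrite -[_ == _]/((vdeg m, xdeg m) == (vdeg m', xdeg m')).
  by rewrite xpair_eqE => /andP[/eqP eq_v /eqP eq_x]; apply: mcongr_vdeg_xdeg.
move/eqP; rewrite -[_ == _]/(m == m') => /eqP ->; exact: mcongr_refl.
Qed.

(** A monomial times an edge binomial is a difference of two spread monomials with the same [vdeg]
    and [xdeg], hence of the same class and the same degree, so its class sums cancel for every
    bound [b]. *)
Lemma class_sum_bei b c f : f \in J -> class_sum (mclass part) b c f = 0.
Proof.
case/asboolP => q ->; rewrite /class_sum; under eq_bigr do rewrite raddf_sum.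
rewrite exchange_big big1 //= => -[u v] /andP[/= uv _].
rewrite adjE in uv; rewrite edge_binomialE.
rewrite [q _]mpolyE mulr_suml; under eq_bigr do rewrite raddf_sum.
rewrite exchange_big big1 //= => m _.
under eq_bigr do rewrite -scalerAl mcoeffZ mulrBr -!mpolyXD mcoeffB mulrBr.
rewrite sumrB -!mulr_sumr.
rewrite -![\sum_(_ | _) _]/(class_sum (mclass part) b c _) !class_sumX.
have vdegE' : vdeg (m + (xi v + yi u)) = vdeg (m + (xi u + yi v)).
  by rewrite !vdegD !vdeg1 !vertex_lshift !vertex_rshift [(U_(v) + _)%MM]addmC.
have -> : mdeg (m + (xi v + yi u)) = mdeg (m + (xi u + yi v)).
  by rewrite -mdeg_vdeg vdegE' mdeg_vdeg.
have spr : spread part (vdeg (m + (xi u + yi v))).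
  apply/spreadP; exists u, v; split=> //.
    by rewrite !vdegD !vdeg1 vertex_lshift !mnmDE !mnm1E eqxx addnCA.
  by rewrite !vdegD !vdeg1 vertex_rshift !mnmDE !mnm1E eqxx !addnA addnC.
rewrite /mclass vdegE' spr !xdegD !xdeg_lshift !xdeg_rshift.
exact: subrr.
Qed.

End MultipartiteIdeal.

(** * Counting classes *)

Definition monomials (N d : nat) : seq 'X_{1..N} :=
  [seq s2m t | t : d.-tuple 'I_N <- enum (basis N d)].

Lemma mem_monomials N d (m : 'X_{1..N}) : (m \in monomials N d) = (mdeg m == d).
Proof. by rewrite (basis_cover d m). Qed.

Lemma monomials_uniq N d : uniq (monomials N d).
Proof. exact: uniq_basis. Qed.

Lemma size_monomials N d : size (monomials N d) = 'C((d + N).-1, d).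
Proof.
case: N => [|N]; last by rewrite addnS /monomials size_basis.
(* Without variables the predecessor is truncated: the formula gives [C(0,0) = 1] in degree 0 and
   [C(d-1,d) = 0] in degree [d > 0]. *)
rewrite addn0; case: d => [|d].
  rewrite bin0 -[RHS]/(size [:: 0%MM : 'X_{1..0}]); apply/perm_size.
  apply: uniq_perm => //; first exact: monomials_uniq.
  move=> m; have -> : m = 0%MM by apply/mnmP => -[].
  by rewrite mem_monomials mdeg0 mem_head.
rewrite bin_small //; apply/eqP; rewrite size_eq0.
case def_s: (monomials 0 d.+1) => [//|m s].
have : m \in monomials 0 d.+1 by rewrite def_s mem_head.
by rewrite mem_monomials mdegE big_ord0.
Qed.

Lemma count_supported N d (A : pred 'I_N) :
  count (supported A) (monomials N d) = 'C((d + #|A|).-1, d).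
Proof.
(* Extension by zero: for [i] outside [A] the index is the length of [enum A], so [nth] returns its
   default 0. *)
pose ext (t : 'X_{1..#|A|}) : 'X_{1..N} :=
  [multinom nth 0%N t (index i (enum A)) | i < N].
have ext_val t j : ext t (enum_val j) = t j.
  by rewrite mnmE (mnm_nth 0%N) /enum_val index_uniq ?enum_uniq // -cardE.
have ext0 t i : ~~ A i -> ext t i = 0%N.
  move=> Ai; rewrite mnmE nth_default // memNindex ?mem_enum //.
  by rewrite size_tuple cardE.
have ext_inj : injective ext.
  by move=> t1 t2 eq_t; apply/mnmP => j; rewrite -!ext_val eq_t.
rewrite -size_filter -size_monomials -(size_map ext); apply/perm_size/uniq_perm.
- by rewrite filter_uniq // monomials_uniq.
- by rewrite map_inj_uniq // monomials_uniq.
have mdeg_ext t : mdeg (ext t) = mdeg t.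
  rewrite !mdegE (bigID A) /= [X in (_ + X)%N]big1 => [|i /ext0 //].
  by rewrite addn0 big_enum_val; apply: eq_bigr => j _; apply: ext_val.
move=> m; rewrite mem_filter mem_monomials.
apply/andP/mapP => [[sup mdeg_m]|[t + ->]]; last first.
  rewrite mem_monomials mdeg_ext => ->; split=> //; apply/supportedP => u.
  by apply: contraR => /ext0 ->.
have mE : m = ext [multinom m (enum_val j) | j < #|A|].
  apply/mnmP => i; have [Ai|nAi] := boolP (A i); last first.
    by rewrite ext0 //; apply/eqP; apply: contraR nAi => /(supportedP _ _ sup).
  by rewrite -(enum_rankK_in Ai Ai) ext_val mnmE.
by eexists; last exact: mE; rewrite mem_monomials -mdeg_ext -mE.
Qed.

(** Double counting: in positive degree a monomial that is not spread is supported on exactly one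
    part. *)
Lemma count_nspread N k (col : 'I_N -> 'I_k) d : (0 < d)%N ->
  count (predC (spread col)) (monomials N d) =
  (\sum_(i < k) 'C((d + #|[pred u | col u == i]|).-1, d))%N.
Proof.
move=> d0; rewrite -sum1_count big_mkcond /=.
under [RHS]eq_bigr do rewrite -count_supported -sum1_count big_mkcond /=.
rewrite exchange_big; apply: eq_big_seq => m.
rewrite mem_monomials => /eqP mdeg_m.
apply/esym/sum_supported_col.
by rewrite -mdeg_eq0 mdeg_m -lt0n.
Qed.

Lemma subm_of_mdeg N (a : 'X_{1..N}) j : (j <= mdeg a)%N ->
  exists2 b : 'X_{1..N}, (b <= a)%MM & mdeg b = j.
Proof.
elim: j => [_|j IHj lt_j].
  by exists 0%MM; rewrite ?mdeg0 //; apply/mnm_lepP => i; rewrite mnm0E.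
have [b le_ba mdeg_b] := IHj (ltnW lt_j).
have [v lt_v] : exists v, (b v < a v)%N.
  apply/existsP; apply: contraLR lt_j; rewrite negb_exists -leqNgt.
  move=> /forallP le_ab.
  rewrite -mdeg_b !mdegE; apply: leq_sum => v _.
  by rewrite leqNgt; apply: le_ab.
exists (b + U_(v))%MM; last by rewrite mdegD mdeg1 mdeg_b addn1.
apply/mnm_lepP => u; rewrite mnmDE mnm1E.
by case: eqP => [<-|_]; rewrite ?addn1 // addn0 (mnm_lepP le_ba).
Qed.

(** A divisor of [a] of degree [j] gives the x-exponents, its complement the y-exponents. Hence each
    spread vertex degree of total [d] carries [d + 1] classes. *)
Lemma vdeg_xdeg_surj n (a : 'X_{1..n}) j : (j <= mdeg a)%N ->
  exists2 m : 'X_{1..n + n}, vdeg m = a & xdeg m = j.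
Proof.
move=> /subm_of_mdeg[b /mnm_lepP le_ba <-].
pose m := [multinom match split i with
  | inl v => b v | inr v => a v - b v end | i < n + n]%N.
have mx v : m (lshift n v) = b v by rewrite mnmE (unsplitK (inl v)).
have my v : m (rshift n v) = (a v - b v)%N by rewrite mnmE (unsplitK (inr v)).
exists m; first by apply/mnmP => v; rewrite vdegE mx my subnKC.
by rewrite /xdeg mdegE; apply: eq_bigr => v _.
Qed.

Section MultipartiteDim.
Variables (K : fieldType) (n k : nat) (part : 'I_n -> 'I_k) (G : sgraph n).
Hypothesis adjE : forall u v, adj G u v = (part u != part v).

Definition nspread_count d :=
  count (predC (spread (part \o @vertex n))) (monomials (n + n) d).
Definition spread_count d := count (spread part) (monomials n d).

Lemma has_dim_bei_quot d :
  has_dim (@bei_quot_piece K n G d) (nspread_count d + d.+1 * spread_count d).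
Proof.
pose js := iota 0 d.+1.
have mem_js j : (j \in js) = (j <= d)%N by rewrite mem_iota ltnS.
(* All classes in degree [d]: the monomials that are not spread, each alone, and the pairs of a
   spread vertex degree and an x-degree between 0 and [d]. *)
pose cs : seq ('X_{1..n + n} + 'X_{1..n} * nat) :=
  [seq inl m | m <- monomials (n + n) d & ~~ spread (part \o @vertex n) m] ++
  [seq inr aj | aj <-
    [seq (a, j) | a <- [seq a <- monomials n d | spread part a],
                  j <- js]].
have -> : (nspread_count d + d.+1 * spread_count d = size cs)%N.
  rewrite size_cat !size_map size_allpairs !size_filter size_iota.
  by rewrite [(d.+1 * _)%N]mulnC.
apply: (@has_dim_classes K (n + n) _ (mclass part) (@bei K n G)).
- exact: mclass_congr.
- exact: class_sum_bei.
- rewrite cat_uniq; apply/and3P; split.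
  + by rewrite map_inj_uniq ?filter_uniq ?monomials_uniq // => x y [].
  + by apply/hasPn => _ /mapP[aj _ ->]; apply/mapP => -[].
  rewrite map_inj_uniq => [|x y []//].
  rewrite allpairs_uniq ?filter_uniq ?monomials_uniq ?iota_uniq //.
  by move=> [? ?] [].
- move=> c; rewrite mem_cat.
  move=> /orP[/mapP[m]|/mapP[_ /allpairsP[[a j] /= [+ + ->]] ->]].
    rewrite mem_filter mem_monomials => /andP[nspr /eqP mdeg_m ->].
    by exists m; rewrite // /mclass spread_vdeg (negPf nspr).
  rewrite mem_filter mem_monomials mem_js => /andP[spr /eqP mdeg_a] le_j.
  rewrite -mdeg_a in le_j; have [m vm xm] := vdeg_xdeg_surj le_j.
  by exists m; rewrite ?mdeg_a -?mdeg_vdeg ?vm // /mclass vm spr xm.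
move=> m mdeg_m; rewrite mem_cat /mclass; case: ifP => spr; apply/orP.
  right; apply/map_f/allpairs_f.
    by rewrite mem_filter spr mem_monomials mdeg_vdeg mdeg_m eqxx.
  rewrite mem_js -mdeg_m -mdeg_vdeg mdegE.
  by apply: leq_sum => v _; rewrite vdegE leq_addr.
left; apply/map_f.
by rewrite mem_filter -spread_vdeg spr mem_monomials mdeg_m eqxx.
Qed.

End MultipartiteDim.

(** * The Hilbert series *)

Section FpsCoefficients.
Variable R : comNzRingType.
Implicit Types f g : fps R.

Lemma fps_coefN f d : fps_coef (- f) d = - fps_coef f d.
Proof. by []. Qed.

Lemma fps_coef_sum (J : Type) (r : seq J) (P : pred J) (F : J -> fps R) d :
  fps_coef (\sum_(j <- r | P j) F j) d = \sum_(j <- r | P j) fps_coef (F j) d.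
Proof. by elim/big_rec2: _ => // j x y _ <-. Qed.

Lemma fps_coefMn f c d : fps_coef (f *+ c) d = fps_coef f d *+ c.
Proof. by elim: c => [|c IHc]; rewrite ?mulr0n // !mulrS fps_coefD IHc. Qed.

Lemma fps_coefXM0 f : fps_coef ('T * f) 0 = 0.
Proof. by rewrite fps_coefM big_ord_recl big_ord0 /= coefX mul0r addr0. Qed.

Lemma fps_coefXMS f d : fps_coef ('T * f) d.+1 = fps_coef f d.
Proof.
rewrite fps_coefM 2!big_ord_recl /= !coefX mul0r add0r mul1r big1 ?addr0.
  by rewrite /bump /= subSS subn0.
by move=> i _; rewrite coefX mul0r.
Qed.

End FpsCoefficients.

Definition binomial_series r : fps int := Fps (fun d => ('C((d + r).-1, d))%:Z).

(** By Pascal's rule, multiplication by [1 - 'T] lowers [r] by one, down to the series 1 at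
    [r = 0]. *)
Lemma binomial_seriesE r : binomial_series r = 1 / (1 - 'T) ^+ r.
Proof.
have subX_unit := unitrX r (fps_subX_unit int).
apply: (mulIr subX_unit); rewrite divrK //.
elim: r {subX_unit} => [|r IHr].
  rewrite expr0 mulr1; apply: fps_ext => -[|d] /=; rewrite coef1 //.
  by rewrite addn0 bin_small.
rewrite exprS mulrA -[RHS]IHr; congr (_ * _).
rewrite mulrBr mulr1 [_ * 'T]mulrC.
apply: fps_ext => -[|d]; rewrite fps_coefD fps_coefN.
  by rewrite fps_coefXM0 subr0 /= !bin0.
by rewrite fps_coefXMS /= !addnS /= binS PoszD addrK.
Qed.

Lemma fps_coef_geometric r d :
  fps_coef (1 / (1 - 'T) ^+ r : fps int) d = ('C((d + r).-1, d))%:Z.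
Proof. by rewrite -binomial_seriesE. Qed.

(** For positive [c] this is the Hilbert series of the ring defined by the 2-minors of a generic 2
    by [c] matrix. *)
Lemma fps_coef_determinantal c d :
  fps_coef (((c%:R - 1) * 'T + 1) / (1 - 'T) ^+ (c + 1) : fps int) d =
  (d.+1 * 'C((d + c).-1, d))%:Z.
Proof.
rewrite -[_^-1]mul1r -binomial_seriesE.
rewrite mulrDl mul1r -mulrA mulrBl mul1r mulr_natl !fps_coefD fps_coefN
  fps_coefMn.
case: d => [|d]; first by rewrite !fps_coefXM0 /= mul0rn subr0 add0r !bin0.
rewrite !fps_coefXMS /= !addn1 !addnS /=.
(* With [(d+1) C(d+c,d+1) = c C(d+c,d)] and Pascal's rule, both sides become [(d+2) C(d+c,d+1)]. *)
have := mul_bin_left (d + c) d; rewrite addKn => mulE.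
have := binS (d + c) d => binE.
rewrite -mulr_natl binE; nia.
Qed.

(** * Chains of primes *)

Section ChainOfKernels.
Variables (K : fieldType) (N M : nat) (I : idealr {mpoly K[N]}).
Local Notation A := {ideal_quot I}.

Definition kill_vars (j : nat) : {mpoly K[M]} -> {mpoly K[M]} :=
  mmap (@mpolyC M K) (fun i : 'I_M => if (i < j)%N then 0 else 'X_i).
HB.instance Definition _ j := GRing.RMorphism.on (kill_vars j).

Lemma kill_varsX j i : kill_vars j 'X_i = if (i < j)%N then 0 else 'X_i.
Proof. by rewrite /kill_vars mmapX mmap1U. Qed.

Lemma kill_varsS j f : kill_vars j.+1 (kill_vars j f) = kill_vars j.+1 f.
Proof.
rewrite [kill_vars j f]/kill_vars /mmap rmorph_sum [RHS]/kill_vars /mmap.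
apply: eq_bigr => m _; rewrite rmorphM /= [kill_vars _ _%:MP]mmapC.
congr (_ * _).
rewrite rmorph_prod; apply: eq_bigr => i _; rewrite rmorphXn /=; congr (_ ^+ _).
case: ifP => [lt_ij|_]; last exact: kill_varsX.
by rewrite rmorph0 ltnS ltnW.
Qed.

Variable phi : {rmorphism {mpoly K[N]} -> {mpoly K[M]}}.
Hypothesis phi0 : forall f, f \in I -> phi f = 0.
Hypothesis phi_strict : forall j, (j < M)%N ->
  exists2 f, kill_vars j (phi f) != 0 & kill_vars j.+1 (phi f) = 0.

(** The primes are the kernels of [phi] followed by killing the first [j] variables: they are prime
    because the target is a domain, and [phi_strict] separates consecutive ones. *)
Lemma prime_chain_kernels : exists P : nat -> {pred A}, prime_chain M P.
Proof.
pose psi j (a : A) := kill_vars j (phi (repr a)).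
(* The value does not depend on the representative, because [phi] vanishes on [I]. *)
have psi_pi j f : psi j (\pi f) = kill_vars j (phi f).
  apply/eqP; rewrite -subr_eq0 -!rmorphB phi0 ?rmorph0 //.
  by rewrite Quotient.idealrBE reprK.
have psi0 j : psi j 0 = 0 by rewrite -[0](rmorph0 \pi_A) psi_pi !rmorph0.
have psi1 j : psi j 1 = 1 by rewrite -[1](rmorph1 \pi_A) psi_pi !rmorph1.
have psiD j a b : psi j (a + b) = psi j a + psi j b.
  by rewrite -[a]reprK -[b]reprK -rmorphD !psi_pi !rmorphD.
have psiM j a b : psi j (a * b) = psi j a * psi j b.
  by rewrite -[a]reprK -[b]reprK -rmorphM !psi_pi !rmorphM.
have [P in_P] : exists P : nat -> {pred A},
    forall j a, (a \in P j) = (psi j a == 0).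
  by exists (fun j a => psi j a == 0).
exists P; split=> [j _|j lt_jM].
  split; first split=> [||a u v].
  - by rewrite in_P psi0.
  - by rewrite in_P psi1 oner_eq0.
  - rewrite in_P => /eqP pu; rewrite in_P => /eqP pv.
    by rewrite in_P psiD psiM pu pv mulr0 addr0.
  by move=> a b; rewrite !in_P psiM mulf_eq0.
split=> [a|].
  rewrite in_P => /eqP pa; rewrite in_P /psi -kill_varsS.
  by rewrite [kill_vars j _]pa rmorph0.
have [f kf0 kf1] := phi_strict lt_jM.
move=> /(_ (\pi f)); rewrite in_P psi_pi kf1 eqxx => /(_ isT).
rewrite in_P psi_pi.
exact/negP.
Qed.

End ChainOfKernels.

Section MultipartiteChains.
Variables (K : fieldType) (n k : nat) (part : 'I_n -> 'I_k) (G : sgraph n).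
Hypothesis adjE : forall u v, adj G u v = (part u != part v).
Local Notation A := {ideal_quot (@bei K n G)}.

Lemma mmap_bei M (h : 'I_(n + n) -> {mpoly K[M]}) f :
  (forall u v, part u != part v ->
    h (lshift n u) * h (rshift n v) = h (lshift n v) * h (rshift n u)) ->
  f \in @bei K n G -> mmap (@mpolyC M K) h f = 0.
Proof.
move=> h_edge /asboolP[c ->]; rewrite rmorph_sum big1 //=.
move=> [u v] /andP[/= uv _]; rewrite adjE in uv.
rewrite rmorphM rmorphB !rmorphM /= !mmapX !mmap1U.
by rewrite h_edge // subrr mulr0.
Qed.

(** Sending the variables outside part [i] to 0 kills every edge binomial, as each edge has an
    endpoint outside the part; the variables of the part stay free. *)
Lemma prime_chain_part (i : 'I_k) :
  exists P : nat -> {pred A},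
    prime_chain #|[pred u : 'I_(n + n) | part (vertex u) == i]| P.
Proof.
set B := [pred u | _].
pose h u : {mpoly K[#|B|]} := \sum_(j < #|B| | enum_val j == u) 'X_j.
have h_val j : h (enum_val j) = 'X_j.
  by rewrite /h (big_pred1 j) // => j'; apply/inj_eq/enum_val_inj.
have h0 u : u \notin B -> h u = 0.
  move=> uB; rewrite /h big_pred0 // => j; apply: contraNF uB => /eqP <-.
  exact: enum_valP.
apply: (@prime_chain_kernels _ _ _ _ (mmap (@mpolyC #|B| K) h)) => [f|j lt_j].
  have h0' v : part v != i -> (h (lshift n v) = 0) * (h (rshift n v) = 0).
    by move=> vi; split; apply: h0; rewrite inE ?vertex_lshift ?vertex_rshift.
  apply: mmap_bei => u v uv; have [ui|/h0' ui] := eqVneq (part u) i.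
    have /h0' vi : part v != i by rewrite -ui eq_sym.
    by rewrite !vi mulr0 mul0r.
  by rewrite !ui mulr0 mul0r.
exists 'X_(enum_val (Ordinal lt_j));
  rewrite /= mmapX mmap1U h_val kill_varsX /= ?ltnn.
  by rewrite -mpoly.msize_poly_eq0 msizeX.
by rewrite ltnSn.
Qed.

Lemma prime_chain_determinantal : (0 < n)%N ->
  exists P : nat -> {pred A}, prime_chain n.+1 P.
Proof.
move=> n_gt0.
(* The toric parametrization of the 2-minors, with ['X_0] as [s]; killing [s]
   and then the [z_v] one by one gives n + 1 strict inclusions. *)
pose h u : {mpoly K[n.+1]} :=
  'X_(lift ord0 (vertex u)) * (if split u is inl _ then 'X_ord0 else 1).
have hx v : h (lshift n v) = 'X_(lift ord0 v) * 'X_ord0.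
  by rewrite /h vertex_lshift (unsplitK (inl v)).
have hy v : h (rshift n v) = 'X_(lift ord0 v).
  by rewrite /h vertex_rshift (unsplitK (inr v)) mulr1.
have X_neq0 i : 'X_i != 0 :> {mpoly K[n.+1]}.
  by rewrite -mpoly.msize_poly_eq0 msizeX.
apply: (@prime_chain_kernels _ _ _ _ (mmap (@mpolyC n.+1 K) h)).
  move=> f; apply: mmap_bei => u v _.
  by rewrite !hx !hy mulrAC [RHS]mulrAC [X in X * _ = _]mulrC.
(* [x_0], mapped to [s z_0], witnesses the killing of [s]; then [y_j], mapped to [z_j], witnesses
   the killing of [z_j]. Indices are shifted by one because [s] is the first variable. *)
move=> [_|j lt_j].
  exists 'X_(lshift n (Ordinal n_gt0));
    rewrite /= mmapX mmap1U hx rmorphM /= !kill_varsX /=.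
    by rewrite mulf_neq0.
  by rewrite mulr0.
rewrite ltnS in lt_j.
exists 'X_(rshift n (Ordinal lt_j)); rewrite /= mmapX mmap1U hy kill_varsX /=.
  by rewrite ltnn.
by rewrite ltnSn.
Qed.

End MultipartiteChains.

Lemma card_vertex n (P : pred 'I_n) :
  #|[pred u : 'I_(n + n) | P (vertex u)]| = (2 * #|P|)%N.
Proof.
rewrite -!sum1_card mul2n -addnn big_split_ord /=.
by congr (_ + _)%N; apply: eq_bigl => v;
  rewrite !inE ?vertex_lshift ?vertex_rshift.
Qed.

Lemma card_tagnat_sig1 k (p : 'I_k -> nat) i :
  #|[pred v : 'I_(\sum_(i < k) p i) | tagnat.sig1 v == i]| = p i.
Proof.
rewrite -[RHS]card_ord -(card_codom (f := @tagnat.Rank k p i)); last first.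
  move=> j j' /(congr1 val) /eqP; rewrite tagnat.eq_Rank eqxx => /eqP.
  exact: val_inj.
apply: eq_card => v; rewrite !inE; apply/eqP/codomP => [<-|[j ->]].
  by exists (tagnat.sig2 v); rewrite tagnat.sig2K.
exact: tagnat.Rank1K.
Qed.

(** * Hilbert function and multiplicity *)

(** For positive [r] this is [C(d+r-1,r-1)], of degree [r-1] in [d]; the induction rests on
    [d+r+1 <= (r+1)(d+1)]. *)
Lemma bin_leq_exp d r : ('C((d + r).-1, d) <= d.+1 ^ r.-1)%N.
Proof.
case: r => [|r]; first by rewrite addn0; case: d => [|d] //; rewrite bin_small.
rewrite addnS /= -[X in 'C(_, X)](addnK r) bin_sub ?leq_addl //.
elim: r => [|r IHr]; first by rewrite bin0.
rewrite -(leq_pmul2l (ltn0Sn r)) addnS -mul_bin_diag expnS /=.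
apply: (@leq_trans ((r.+1 * d.+1) * 'C(d + r, r))%N).
  by rewrite leq_mul2r; apply/orP; right; nia.
by rewrite mulnA leq_mul2l IHr orbT.
Qed.

Lemma count_nspread0 N k (col : 'I_N -> 'I_k) :
  count (predC (spread col)) (monomials N 0) = 1%N.
Proof.
rewrite (@eq_in_count _ _ predT) ?count_predT ?size_monomials ?bin0 // => m.
rewrite mem_monomials mdeg_eq0 => /eqP ->; apply/negP => /spreadP[u [v []]].
by rewrite mnm0E eqxx.
Qed.

Section HilbertFunction.
Variables (n k : nat) (part : 'I_n -> 'I_k) (p : 'I_k -> nat).
Hypothesis card_part : forall i, #|[pred v | part v == i]| = p i.

Definition bei_hilbert d :=
  (nspread_count part d + d.+1 * spread_count part d)%N.

Lemma bei_hilbertE d :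
  (bei_hilbert d)%:Z = \sum_(i < k) ('C((d + 2 * p i).-1, d))%:Z
    - \sum_(i < k) (d.+1 * 'C((d + p i).-1, d))%:Z
    + (d.+1 * 'C((d + n).-1, d))%:Z.
Proof.
have spreadE : (spread_count part d)%:Z =
    ('C((d + n).-1, d))%:Z - (count (predC (spread part)) (monomials n d))%:Z.
  by rewrite -size_monomials -(count_predC (spread part)) PoszD addrK.
rewrite /bei_hilbert PoszD PoszM spreadE.
(* In degree 0 the two sums over the parts both equal [k] and cancel, leaving the constant
   monomial. *)
case: d {spreadE} => [|d].
  rewrite /nspread_count !count_nspread0 !bin0 subrr mulr0 addr0.
  under eq_bigr do rewrite bin0.
  under [X in _ - X]eq_bigr do rewrite bin0.
  by rewrite subrr add0r.
rewrite /nspread_count !count_nspread // mulrBr addrA addrAC.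
rewrite PoszM; congr (_ - _ + _).
  rewrite -[LHS]natz natr_sum; apply: eq_bigr => i _.
  by rewrite natz -card_part -card_vertex.
under [RHS]eq_bigr do rewrite PoszM; rewrite -mulr_sumr; congr (_ * _).
rewrite -[LHS]natz natr_sum; apply: eq_bigr => i _.
by rewrite natz card_part.
Qed.

Lemma bei_hilbert_leq d e : (0 < n)%N ->
  (forall i, 2 * p i <= e.+1)%N -> (n <= e)%N ->
  (bei_hilbert d <= k.+1 * d.+1 ^ e)%N.
Proof.
move=> n_gt0 le_p le_n.
have h_le : (bei_hilbert d <= \sum_(i < k) 'C((d + 2 * p i).-1, d)
    + d.+1 * 'C((d + n).-1, d))%N.
  rewrite -lez_nat bei_hilbertE PoszD Num.Theory.lerD2r.
  rewrite -[X in (_ <= X)%R]natz natr_sum.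
  under [X in (_ <= X)%R]eq_bigr do rewrite natz.
  rewrite Num.Theory.lerBlDr Num.Theory.lerDl; exact: Num.Theory.sumr_ge0.
apply: leq_trans h_le _; rewrite [(k.+1 * _)%N]mulSn addnC; apply: leq_add.
  apply: (@leq_trans (d.+1 * d.+1 ^ n.-1)%N).
    by rewrite leq_mul2l bin_leq_exp orbT.
  by rewrite -expnS prednK // leq_pexp2l.
rewrite -[X in (_ <= X * _)%N](card_ord k) -sum_nat_const.
apply: leq_sum => i _; apply: leq_trans (bin_leq_exp _ _) _.
by rewrite leq_pexp2l // -subn1 leq_subLR.
Qed.

End HilbertFunction.

(** * The common numerator and its value at 1 *)

Lemma fps_of_poly_reduce (R : comUnitRingType) (q : {poly R}) c D :
  (c <= D)%N ->
  fps_of_poly (q * (1 - 'X) ^+ (D - c)) / (1 - 'T) ^+ D =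
  fps_of_poly q / (1 - 'T) ^+ c.
Proof.
move=> le_cD; have u c' := unitrX c' (fps_subX_unit R).
apply: (mulIr (u D)); rewrite divrK //.
rewrite rmorphM rmorphXn rmorphB rmorph1 /=.
by rewrite -mulrA -[in RHS](subnKC le_cD) exprD mulKr.
Qed.

(* The numerator of the Hilbert series over the denominator (1 - t)^D; the
   truncated subtractions are exact when D bounds all the exponents. *)
Definition multipartite_numerator (k : nat) (p : 'I_k -> nat) (n D : nat) :
    {poly int} :=
  \sum_(i < k) 1 * (1 - 'X) ^+ (D - 2 * p i)
  - \sum_(i < k) (((p i)%:R - 1) * 'X + 1) * (1 - 'X) ^+ (D - (p i + 1))
  + ((n%:R - 1) * 'X + 1) * (1 - 'X) ^+ (D - (n + 1)).

Lemma fps_of_multipartite_numerator (k : nat) (p : 'I_k -> nat) (n D : nat) :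
  (forall i, 2 * p i <= D)%N -> (forall i, p i <= n)%N -> (n < D)%N ->
  fps_of_poly (multipartite_numerator p n D) / (1 - 'T) ^+ D =
  \sum_(i < k) 1 / (1 - 'T) ^+ (2 * p i)
  - \sum_(i < k) (((p i)%:R - 1) * 'T + 1) / (1 - 'T) ^+ (p i + 1)
  + ((n%:R - 1) * 'T + 1) / (1 - 'T) ^+ (n + 1).
Proof.
move=> le_p le_pn lt_nD.
have detE c :
    fps_of_poly ((c%:R - 1) * 'X + 1) = (c%:R - 1) * 'T + 1 :> fps int.
  by rewrite rmorphD rmorphM rmorphB rmorph_nat rmorph1.
rewrite /multipartite_numerator rmorphD rmorphB !rmorph_sum.
rewrite mulrDl mulrBl !mulr_suml; congr (_ - _ + _).
- by apply: eq_bigr => i _; rewrite [LHS]fps_of_poly_reduce.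
- apply: eq_bigr => i _; rewrite [LHS]fps_of_poly_reduce ?detE //.
  by rewrite addn1 (leq_ltn_trans (le_pn i)).
by rewrite fps_of_poly_reduce ?detE ?addn1.
Qed.

(** At [t = 1] only the fractions whose pole has the full order [D] survive, and [(c-1)t + 1] takes
    the value [c]. *)
Lemma horner_multipartite_numerator (k : nat) (p : 'I_k -> nat) (n D : nat) :
  (forall i, 2 * p i <= D)%N -> (forall i, p i <= n)%N -> (n < D)%N ->
  (multipartite_numerator p n D).[1] =
  \sum_(i < k) (2 * p i == D)%:R
  - \sum_(i < k) (p i)%:R * (p i + 1 == D)%:R + n%:R * (n + 1 == D)%:R.
Proof.
move=> le_p le_pn lt_nD.
have powE c : (c <= D)%N -> ((1 - 'X) ^+ (D - c)).[1] = (c == D)%:R :> int.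
  move=> le_cD; rewrite horner_exp !hornerE subrr expr0n.
  by rewrite subn_eq0 eqn_leq le_cD.
have detE c : ((c%:R - 1) * 'X + 1 : {poly int}).[1] = c%:R.
  by rewrite !hornerE -polyC_natr hornerC subrK.
rewrite /multipartite_numerator !(hornerD, hornerN, horner_sum).
congr (_ - _ + _).
- by apply: eq_bigr => i _; rewrite mul1r powE.
- apply: eq_bigr => i _; rewrite hornerM detE powE //.
  by rewrite addn1 (leq_ltn_trans (le_pn i)).
by rewrite hornerM detE powE // addn1.
Qed.

Section PartSizes.
Variables (k : nat) (p : 'I_k -> nat) (i0 : 'I_k).
Hypothesis p_pos : forall i, (0 < p i)%N.
Hypothesis p_max : forall i, (p i <= p i0)%N.
Local Notation n := (\sum_(i < k) p i)%N.
Local Notation D := (maxn (2 * p i0) (n + 1)).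

Lemma part_size_leq i : (p i <= n)%N.
Proof. by rewrite (bigD1 i) //= leq_addr. Qed.

Lemma part_sizeD_leq i : i != i0 -> (p i + p i0 <= n)%N.
Proof.
by move=> iN; rewrite (bigD1 i0) //= (bigD1 i) //= addnC leq_add2l leq_addr.
Qed.

Lemma numerator_at_1 :
  (multipartite_numerator p n D).[1] =
  if (p i0 == 1)%N || (2 * p i0 < n + 1)%N then n%:Z
  else if (n + 1 < 2 * p i0)%N then 1 else (n + 1)%:Z.
Proof.
rewrite horner_multipartite_numerator => [|i|i|]; first last.
- by rewrite leq_max addn1 leqnn orbT.
- exact: part_size_leq.
- by rewrite leq_max leq_mul2l p_max.
have [[p_gt0 p_n] pD_n] := (p_pos i0, part_size_leq i0, @part_sizeD_leq).
move: n p_n pD_n => m p_n pD_n.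
(* For [i] other than [i0], [2 p_i <= p_i + p_i0 <= n < D]. *)
rewrite (bigD1 i0) //= big1 ?addr0 => [|i iN]; last first.
  by have := (p_max i, pD_n i iN); case: eqP => // + []; lia.
(* Likewise [p_i + 1 <= p_i + p_i0 <= n < D]. *)
rewrite (bigD1 i0) //= big1 ?addr0 => [|i iN]; last first.
  by have := (p_max i, pD_n i iN); case: eqP => [|_];
    rewrite ?mulr0 // => + []; lia.
(* The remaining negative term survives only for [n = 1], where [2 p_i0 = n + 1] and it lowers
   [n + 1] to [n]; hence the separate case [p_i0 = 1]. *)
move: (p i0) p_gt0 p_n => q q_gt0 q_m; clear -q_gt0 q_m.
case: (2 * q =P _)%N; case: (q + 1 =P _)%N; case: (m + 1 =P _)%N;
  case: (q =P 1)%N; case: (ltnP (2 * q) (m + 1));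
  case: (ltnP (m + 1) (2 * q)) => /=; lia.
Qed.

End PartSizes.

Theorem corollary4p14 (K : fieldType) (k : nat) (hk : (0 < k)%N)
    (p : 'I_k -> nat)
    (p_pos : forall i, (0 < p i)%N)
    (p_dec : forall i j : 'I_k, (i <= j)%N -> (p j <= p i)%N) :
  let n := (\sum_(i < k) p i)%N in
  let p1 := p (Ordinal hk) in
  let G := complete_multipartite p in
  [/\ hilbert_series (@bei_quot_piece K n G)
        (\sum_(i < k) 1 / (1 - 'T) ^+ (2 * p i)
         - \sum_(i < k) (((p i)%:R - 1) * 'T + 1) / (1 - 'T) ^+ (p i + 1)
         + ((n%:R - 1) * 'T + 1) / (1 - 'T) ^+ (n + 1)),
      krull_dim (bei_quot K G) (maxn (2 * p1) (n + 1))
    & multiplicity (@bei_quot_piece K n G)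
        (if (p1 == 1)%N || (2 * p1 < n + 1)%N then n%:Z
         else if (n + 1 < 2 * p1)%N then 1
         else (n + 1)%:Z)].
Proof.
move=> n p1 G; pose part := @tagnat.sig1 k p.
have adjE u v : adj G u v = (part u != part v) by [].
have p_max i : (p i <= p1)%N by apply: p_dec.
have n_gt0 : (0 < n)%N.
  by rewrite (leq_trans (p_pos (Ordinal hk))) // part_size_leq.
have card_part i : #|[pred v | part v == i]| = p i by apply: card_tagnat_sig1.
set D := maxn _ _.
have D_gt0 : (0 < D)%N by rewrite leq_max addn1 orbT.
have le_pD i : (2 * p i <= D)%N by rewrite leq_max leq_mul2l p_max.
have lt_nD : (n < D)%N by rewrite leq_max addn1 leqnn orbT.
have dimK : krull_dim (bei_quot K G) D.
  split.
    rewrite /D /maxn; case: ifP => _.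
      have [P chP] := prime_chain_determinantal K adjE n_gt0.
      by exists P; rewrite addn1.
    have [P] := prime_chain_part K adjE (Ordinal hk).
    by rewrite (card_vertex (fun v => part v == _)) card_part; exists P.
  (* The Hilbert function is bounded by a multiple of [d.+1 ^ D.-1], so chains have length at most
     [D]. *)
  rewrite -(prednK D_gt0) in le_pD lt_nD *.
  apply: (quot_prime_chain_leq (has_dim_bei_quot K adjE)) => d.
  exact: bei_hilbert_leq.
have hilb : hilbert_series (@bei_quot_piece K n G)
        (\sum_(i < k) 1 / (1 - 'T) ^+ (2 * p i)
         - \sum_(i < k) (((p i)%:R - 1) * 'T + 1) / (1 - 'T) ^+ (p i + 1)
         + ((n%:R - 1) * 'T + 1) / (1 - 'T) ^+ (n + 1)).
  move=> d; exists (bei_hilbert part d); first exact: has_dim_bei_quot.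
  rewrite (bei_hilbertE card_part) !fps_coefD fps_coefN !fps_coef_sum.
  rewrite fps_coef_determinantal; congr (_ - _ + _); apply: eq_bigr => i _.
    exact: fps_coef_geometric.
  exact: fps_coef_determinantal.
split=> //; exists D, (multipartite_numerator p n D); split=> //.
  by rewrite fps_of_multipartite_numerator // => i; apply: part_size_leq.
by rewrite numerator_at_1.
Qed.
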